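(* Let $A$ be a two-sided skew brace such that $(A,+)$ satisfies the maximum condition on subgroups or, equivalently, $(A,\circ)$ satisfies the maximum condition on subgroups. Then $(A,+)$ is soluble if and only if $(A,\circ)$ is soluble. In this case, $A$ is a soluble skew brace.
   Context: A skew (left) brace is a triple $(A,+,\circ)$ such that $(A,+)$ and $(A,\circ)$ are (not necessarily abelian) groups and $a\circ(b+c)=a\circ b-a+a\circ c$ for all $a,b,c\in A$. The two groups share the same identity element, denoted $0$. It is two-sided if moreover $(a+b)\circ c=a\circ c-c+b\circ c$ for all $a,b,c\in A$. A group satisfies the maximum condition on subgroups if there exists no infinite strictly ascending chain of subgroups; for two-sided skew braces this condition on $(A,+)$ is equivalent to the same condition on $(A,\circ)$. For $a,b\in A$ put $a*b=-a+a\circ b-b$; for $X,Y\subseteq A$ let $X*Y$ be the subgroup of $(A,+)$ generated by $\{x*y\mid x\in X,y\in Y\}$. Define $A_1=A$ and $A_{n+1}=A_n*A_n$ for $n\ge 1$. The skew brace $A$ is soluble if $A_n=\{0\}$ for some $n$. *)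

(* Defs.v *)
From mathcomp Require Import all_boot.
From mathcomp Require Import classical_sets.

Set Implicit Arguments.
Unset Strict Implicit.
Unset Printing Implicit Defensive.

Local Open Scope classical_set_scope.

(* A group law on T as a plain record: a skew brace carries two of them on one
   carrier, which the canonical groupType structure does not allow. *)
Record groupLaw (T : Type) := GroupLaw {
  gop : T -> T -> T;
  gid : T;
  ginv : T -> T;
  gopA : associative gop;
  gop_idl : left_id gid gop;
  gop_invl : left_inverse gid ginv gop
}.

Definition subgroup T (G : groupLaw T) (H : set T) : Prop :=
  [/\ H (gid G),
      forall x y, H x -> H y -> H (gop G x y)
    & forall x, H x -> H (ginv G x)].

Definition generated T (G : groupLaw T) (X : set T) : set T :=
  smallest (subgroup G) X.

Definition max_subgroups T (G : groupLaw T) : Prop :=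
  ~ exists H : nat -> set T,
      (forall n, subgroup G (H n)) /\ (forall n, H n `<` H n.+1).

Definition commutator T (G : groupLaw T) (x y : T) : T :=
  gop G (gop G (ginv G x) (ginv G y)) (gop G x y).

Fixpoint derived_series T (G : groupLaw T) (n : nat) : set T :=
  if n is m.+1 then
    generated G [set commutator G x y
                | x in derived_series G m & y in derived_series G m]
  else [set: T].

Definition soluble_group T (G : groupLaw T) : Prop :=
  exists n, derived_series G n = [set gid G].

Record skewBrace := SkewBrace {
  sb_sort :> Type;
  sb_add : groupLaw sb_sort;
  sb_circ : groupLaw sb_sort;
  sb_distl : forall a b c : sb_sort,
    gop sb_circ a (gop sb_add b c) =
    gop sb_add (gop sb_add (gop sb_circ a b) (ginv sb_add a)) (gop sb_circ a c)
}.

Definition two_sided (A : skewBrace) : Prop :=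
  forall a b c : A,
    gop (sb_circ A) (gop (sb_add A) a b) c =
    gop (sb_add A)
      (gop (sb_add A) (gop (sb_circ A) a c) (ginv (sb_add A) c))
      (gop (sb_circ A) b c).

Definition sb_star (A : skewBrace) (a b : A) : A :=
  gop (sb_add A) (gop (sb_add A) (ginv (sb_add A) a) (gop (sb_circ A) a b))
    (ginv (sb_add A) b).

Definition sb_star_set (A : skewBrace) (X Y : set A) : set A :=
  generated (sb_add A) [set sb_star x y | x in X & y in Y].

(* sb_series A n is A_(n+1): the usual indexing starts from A_1 = A. *)
Definition sb_series (A : skewBrace) (n : nat) : set A :=
  iter n (fun X => sb_star_set X X) [set: A].
Arguments sb_series : clear implicits.

Definition soluble_brace (A : skewBrace) : Prop :=
  exists n, sb_series A n = [set gid (sb_add A)].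

(* Main.v *)
From HB Require Import structures.
From mathcomp Require Import all_boot all_order all_algebra.
From mathcomp Require Import ring zify boolp classical_sets.
Require Import Defs.
Import Pdiv.Idomain.

(* Let P = A * A, let Q be generated by the elements -b + a∘b - a, and let
   I = P ∩ Q. Expanding (a + b)∘(c + d) in two ways shows that P and Q commute
   elementwise in (A, +), so I is a radical ring under + and *. Modulo P the law
   ∘ is +, and modulo Q it is the opposite of +; hence if one of the two groups
   is soluble, a term of the derived series of the other one lies in I, and so
   does a term of the series A_n when (A, +) is soluble. The maximum condition
   makes the radical ring I nilpotent. Indeed for x in I it makes 1 + w b
   invertible in Z[x] for all w and some b associated to x; as Z[X] is a Hilbert
   ring, b and x are nilpotent. So I is nil, and Utumi's proof of Levitzki's
   theorem applies. *)

Set Implicit Arguments.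
Unset Strict Implicit.
Unset Printing Implicit Defensive.

Import Order.TTheory GRing.Theory Num.Theory.
Local Open Scope classical_set_scope.
Local Open Scope ring_scope.

(** * Jacobson radicals of quotients of Z[X] *)

(** The obstacle is that the chain condition is known for one of the two laws only, and it is not
    transferred from one law to the other. Both versions bound chains of right ideals of [I],
    because in a radical ring these are closed under both laws, and Utumi's argument works with such
    chains. Nilness depends on which law is bounded. For additive chains [b = x] works: the inverse
    of [1 + w x] is shown to be a polynomial in [x]. Circle chains bound only groups of units, so
    one works in localizations of [Z[x]]; this is why [b = x g(x)], with [g(x)] invertible a priori
    only in the surrounding ring. To speak of [1 + x] at all, [I] is embedded as an ideal of a
    unital ring. Once [I] is nilpotent, its annihilators [z I^k = 0] form a finite filtration along
    which [*] and the commutators of ∘ lose one step each; this ends both the derived series of ∘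
    and the series [A_n]. For [+], one further commutator suffices, [I] being additively abelian. *)

Definition ideal (S : pzRingType) (K : set S) : Prop :=
  [/\ K 0, forall x y, K x -> K y -> K (x + y)
    & forall r x, K x -> K (r * x) /\ K (x * r)].

Lemma idealMl (S : pzRingType) (K : set S) r x : ideal K -> K x -> K (r * x).
Proof. by case=> _ _ KM /(KM r)[]. Qed.

Lemma idealMr (S : pzRingType) (K : set S) r x : ideal K -> K x -> K (x * r).
Proof. by case=> _ _ KM /(KM r)[]. Qed.

Lemma idealD (S : pzRingType) (K : set S) x y :
  ideal K -> K x -> K y -> K (x + y).
Proof. by case=> _ + _; apply. Qed.

Lemma idealN (S : pzRingType) (K : set S) x : ideal K -> K x -> K (- x).
Proof. by rewrite -mulN1r; apply: idealMl. Qed.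

Lemma idealB (S : pzRingType) (K : set S) x y :
  ideal K -> K x -> K y -> K (x - y).
Proof. by move=> iK Kx Ky; apply: idealD => //; apply: idealN. Qed.

Definition prime_ideal (R : pzRingType) (M : set R) : Prop :=
  [/\ ideal M, ~ M 1 & forall x y, M (x * y) -> M x \/ M y].

Lemma comm_ideal (R : comPzRingType) (K : set R) :
  K 0 -> (forall x y, K x -> K y -> K (x + y)) ->
  (forall r x, K x -> K (r * x)) -> ideal K.
Proof.
by move=> K0 KD KM; split=> // r x Kx; split; [|rewrite mulrC]; apply: KM.
Qed.

(** Krull's argument: an ideal [M] maximal among those avoiding the powers of [b] is prime. If [x]
    and [y] are outside [M], powers of [b] lie in [M + Rx] and in [M + Ry], and their product would
    lie in [M + Rxy]. *)
Lemma exists_prime_ideal (R : comPzRingType) (K : set R) b :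
  ideal K -> (forall n, ~ K (b ^+ n)) ->
  exists M : set R, [/\ prime_ideal M, K `<=` M & ~ M b].
Proof.
move=> iK Kb.
(* Zorn's lemma is applied to the part [X] added to [K], so that the empty chain, whose union is
   empty, yields the ideal [K]. *)
pose P (X : set R) := ideal (K `|` X) /\ forall n, ~ (K `|` X) (b ^+ n).
have [F FP Fch|A [[iA Ab] Amax]] := @Zorn_bigcup R P.
  have sub X : F X -> K `|` X `<=` K `|` \bigcup_(Y in F) Y.
    by move=> FX x [Kx|Xx]; [left|right; exists X].
  have inU x : (K `|` \bigcup_(Y in F) Y) x ->
      K x \/ exists2 X, F X & (K `|` X) x.
    by move=> [|[X FX Xx]]; [left|right; exists X => //; right].
  split; last first.
    by move=> n /inU[/Kb//|[X /FP[_]]]; apply.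
  apply: comm_ideal; first by left; case: iK.
    move=> x y /inU[Kx|[X FX Xx]] /inU[Ky|[Y FY Yy]].
    - by left; apply: idealD.
    - by apply: (sub Y) => //; apply: idealD => //; [case: (FP Y FY)|left].
    - by apply: (sub X) => //; apply: idealD => //; [case: (FP X FX)|left].
    - have [XY|YX] := Fch X Y FX FY.
        apply: (sub Y) => //; apply: idealD => //; first by case: (FP Y FY).
        by case: Xx; [left|move/XY; right].
      apply: (sub X) => //; apply: idealD => //; first by case: (FP X FX).
      by case: Yy; [left|move/YX; right].
  move=> r x /inU[Kx|[X FX Xx]]; first by left; apply: idealMl.
  by apply: (sub X) => //; apply: idealMl => //; case: (FP X FX).
pose M := K `|` A.
have adjoin x : ~ M x -> exists n r, M (b ^+ n - r * x).
  move=> nMx; pose N := [set y | exists r, M (y - r * x)].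
  have MN : M `<=` N by move=> y My; exists 0; rewrite mul0r subr0.
  have iN : ideal N.
    apply: comm_ideal.
    - by apply: MN; case: iA.
    - move=> y z [r My] [s Mz]; exists (r + s).
      by rewrite mulrDl opprD addrACA; apply: idealD.
    - move=> r y [s My]; exists (r * s).
      by rewrite -mulrA -mulrBr; apply: idealMl.
  apply: contrapT => nE; apply: (Amax N).
    split; first by move=> y Ay; apply: MN; right.
    by move=> NA; apply: nMx; right; apply: NA; exists 1; rewrite mul1r subrr;
       case: iA.
  have KN : K `|` N = N.
    by apply/setUidPr => y Ky; apply: MN; left.
  split; rewrite KN // => n [r Mr]; apply: nE; exists n, r; exact: Mr.
exists M; split; last 2 first.
- by move=> x; left.
- by rewrite -[b]expr1; exact: Ab.
split=> //; first by rewrite -(expr0 b); exact: Ab.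
move=> x y Mxy; apply: contrapT => /not_orP[/adjoin[i [r Mi]] /adjoin[j [s Mj]]].
apply: (Ab (i + j)%N); change (M (b ^+ (i + j))).
have -> : b ^+ (i + j) = (b ^+ i - r * x) * b ^+ j + r * x * (b ^+ j - s * y)
   + r * s * (x * y) by rewrite exprD; ring.
by do ![apply: idealD => //; try by [apply: idealMl|apply: idealMr]].
Qed.

(* b lies in every maximal ideal of {poly k} / M, i.e. in its Jacobson radical *)
Definition jacobson_mod (R : pzRingType) (M : set R) (b : R) : Prop :=
  forall w, exists c, M ((1 + w * b) * c - 1).

Section PrimePoly.
Variables (k : idomainType) (M : set {poly k}) (b : {poly k}).
Hypotheses (pM : prime_ideal M) (Mk : forall c : k, M c%:P -> c = 0).
Hypotheses (nMb : ~ M b) (jb : jacobson_mod M b).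

Let iM : ideal M. Proof. by case: pM. Qed.

Let MZ c g : M g -> M (c *: g).
Proof. by rewrite -mul_polyC; apply: idealMl. Qed.

Let MZV c g : c != 0 -> M (c *: g) -> M g.
Proof.
move=> /eqP c0; rewrite -mul_polyC; case: pM => _ _ H /H[/Mk//|//].
Qed.

(** [M] is nonzero because [1 + X b] has positive degree and so is not invertible in [k[X]]. For [f]
    of least size in [M], pseudo-division of [g] by [f] leaves a remainder in [M] that is too small
    to be nonzero. Over the fraction field, [f] thus generates [M]. *)
Lemma prime_poly_generator : exists f, [/\ M f, (1 < size f)%N &
  forall g, M g -> exists n s, lead_coef f ^+ n *: g = s * f].
Proof.
have [f Mf f0] : exists2 f, M f & f != 0.
  have [c Mc] := jb 'X; exists ((1 + 'X * b) * c - 1) => //.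
  apply/eqP => /eqP; rewrite subr_eq0 => /eqP /(congr1 (size \o polyseq))/=.
  have b0 : b != 0 by apply/eqP => b0; apply: nMb; rewrite b0; case: iM.
  have sb : size (1 + 'X * b) = (size b).+1.
    rewrite addrC size_polyDl mulrC size_mulX // size_poly1 ltnS.
    by rewrite size_poly_gt0.
  have sb0 : 1 + 'X * b != 0 by rewrite -size_poly_eq0 sb.
  have [->|c0] := eqVneq c 0; first by rewrite mulr0 size_poly0 size_poly1.
  rewrite size_mul // sb size_poly1 /=.
  move: b0 c0; rewrite -!size_poly_gt0 => b0 c0 E.
  by have {}E : (size b + size c = 1)%N := E; lia.
have [n [[{f0 Mf}f [Mf f0 sf]] nmin]] : exists n,
    (exists f, [/\ M f, f != 0 & size f = n]) /\
    forall g, M g -> g != 0 -> (n <= size g)%N.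
  pose p n := `[< exists f, [/\ M f, f != 0 & size f = n] >].
  have ep : exists n, p n by exists (size f); apply/asboolP; exists f.
  case: (ex_minnP ep) => n /asboolP pn nmin; exists n; split=> // g Mg g0.
  by apply: nmin; apply/asboolP; exists g.
have sf1 : (1 < size f)%N.
  rewrite ltnNge; apply/negP => /size1_polyC f1; move: Mf f0.
  by rewrite f1 => /Mk ->; rewrite eqxx.
exists f; split=> // g Mg; exists (scalp g f), (g %/ f).
rewrite divp_eq; suff -> : g %% f = 0 by rewrite addr0.
apply/eqP/negPn/negP => r0.
have : (n <= size (g %% f)%R)%N.
  apply: nmin => //.
  have -> : g %% f = lead_coef f ^+ scalp g f *: g - g %/ f * f.
    by rewrite divp_eq addrC addKr.
  by apply: idealB; [|apply: MZ|apply: idealMl].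
by rewrite -sf leqNgt ltn_modpN0.
Qed.

(** The gcd [d] of [b] and [f] is outside [M], since it divides [b] up to a constant. By primality
    the cofactor of [d] in [f] is in [M], so its degree is at least that of [f] and [d] is constant.
    Bezout then makes a nonzero constant a multiple of [b] modulo [f]. *)
Lemma prime_poly_const_jacobson : exists2 c, c != 0 & jacobson_mod M c%:P.
Proof.
have [f [Mf sf fgen]] := prime_poly_generator.
have f0 : f != 0 by rewrite -size_poly_gt0 (ltn_trans _ sf).
have [[u v] /= uv] := Bezoutp b f.
set d := gcdp b f in uv.
have nMd : ~ M d.
  have /dvdpP[[c q]/= c0 cq] := dvdp_gcdl b f.
  by move=> Md; apply: nMb; apply: (MZV c0); rewrite cq; apply: idealMl.
have d1 : (size d <= 1)%N.
  have /dvdpP[[c q]/= c0 cq] := dvdp_gcdr b f.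
  have : M (q * d) by rewrite -cq; apply: MZ.
  case: pM => _ _ H /H[Mq|//].
  have [n [s qs]] := fgen _ Mq.
  have lf : lead_coef f ^+ n != 0 by rewrite expf_neq0 ?lead_coef_eq0.
  have d0 : d != 0 by rewrite gcdp_eq0 negb_and f0 orbT.
  have q0 : q != 0.
    apply/eqP => q0; move/eqP: cq; rewrite q0 mul0r scale_poly_eq0.
    by rewrite (negPf c0) (negPf f0).
  have s0 : s != 0.
    by apply/eqP => s0; move/eqP: qs;
       rewrite s0 mul0r scale_poly_eq0 (negPf lf) (negPf q0).
  have E1 : size q = (size s + size f).-1 by rewrite -size_mul // -qs size_scale.
  have E2 : size f = (size q + size d).-1 by rewrite -size_mul // -cq size_scale.
  move: s0 d0 sf q0 E1 E2; rewrite -!size_poly_gt0.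
  by move: (size _) (size _) (size _) (size _) => w x y z; lia.
have /eqpP[[c1 c2]/= /andP[c10 c20] cuv] := uv.
have [e de] : exists e, d = e%:P by exists d`_0; apply: size1_polyC.
have e0 : e != 0 by apply: contra_notN nMd => /eqP e0; rewrite de e0; case: iM.
exists (c2 * e); first exact: mulf_neq0.
move=> w; have [c Mc] := jb (w * c1%:P * u); exists c.
have -> : (1 + w * (c2 * e)%:P) * c - 1 =
   ((1 + w * c1%:P * u * b) * c - 1) + w * c1%:P * v * c * f.
  rewrite polyCM -de mul_polyC -cuv -mul_polyC; ring.
by apply: idealD => //; apply: idealMl.
Qed.

End PrimePoly.

(* A nonzero constant c of the Jacobson radical makes q = 1 + 3 (a c)^2 a unit
   modulo M, where a is the leading coefficient of a generator f. Modulo a prime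
   p dividing q this says that f divides a power of a, although f is not constant
   modulo p. *)
Lemma prime_poly_int (M : set {poly int}) b : prime_ideal M ->
  (forall c, M c%:P -> c = 0) -> jacobson_mod M b -> M b.
Proof.
move=> pM Mk jb; apply: contrapT => nMb.
have iM : ideal M by case: pM.
have [f [Mf sf fgen]] := prime_poly_generator pM Mk nMb jb.
have [c c0 jc] := prime_poly_const_jacobson pM Mk nMb jb.
set a := lead_coef f in fgen.
have a0 : a != 0 by rewrite lead_coef_eq0 -size_poly_gt0 (ltn_trans _ sf).
pose q := 1 + a * (3 * (a * c)) * c.
have q_gt1 : (1 < `|q|)%N.
  have : (0 < (a * c) ^+ 2)%R by rewrite exprn_even_gt0 //= mulf_neq0.
  have -> : q = 1 + 3 * (a * c) ^+ 2 by rewrite /q; ring.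
  lia.
pose p := pdiv `|q|; have pp : prime p by apply: pdiv_prime.
have pq : q%:~R = 0 :> 'F_p.
  apply/eqP; rewrite -(dvdz_pcharf (pchar_Fp pp)).
  exact: pdiv_dvd.
have [v] := jc (a *+ 3 * (a * c))%:P.
rewrite -polyCM.
have -> : 1 + (a *+ 3 * (a * c) * c)%:P = q%:P.
  by rewrite -[1]/(1%:P) -polyCD; congr (_%:P); rewrite /q; ring.
move=> /fgen[n [s /(congr1 (map_poly (intr : int -> 'F_p)))]].
rewrite linearZ/= !rmorphM/= rmorphB/= rmorphM/= map_polyC/= pq polyC0 mul0r sub0r.
rewrite rmorph1 => E.
(* [q] is 1 modulo [a], so [p] does not divide [a] and [f] keeps its degree modulo [p]. *)
have aF : a%:~R != 0 :> 'F_p.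
  apply/eqP => aF; move/eqP: pq.
  by rewrite /q rmorphD !rmorphM /= aF !mul0r addr0 oner_eq0.
have sfF : size (map_poly (intr : int -> 'F_p) f) = size f.
  exact: size_map_poly_id0.
have fF0 : map_poly (intr : int -> 'F_p) f != 0.
  by rewrite -size_poly_gt0 sfF (ltn_trans _ sf).
have E1 : size (map_poly (intr : int -> 'F_p) s * map_poly intr f) = 1%N.
  by rewrite -E size_scale ?rmorphXn ?expf_neq0 // size_polyN size_poly1.
have sF0 : map_poly (intr : int -> 'F_p) s != 0.
  by apply/eqP => s0; rewrite s0 mul0r size_poly0 in E1.
rewrite size_mul // sfF in E1; move: sF0 sf E1; rewrite -size_poly_gt0.
by move: (size _) (size _) => x y; lia.
Qed.

Lemma int_polyP (p : nat) (G : {poly int}) : prime p ->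
  map_poly (intr : int -> 'F_p) G = 0 -> exists H, G = (p%:Z)%:P * H.
Proof.
move=> pp G0; exists (map_poly (fun x : int => (x %/ p%:Z)%Z) G).
apply/polyP => i; rewrite coefCM coef_map_id0 ?div0z //.
have /eqP : (map_poly (intr : int -> 'F_p) G)`_i = 0 by rewrite G0 coef0.
by rewrite coef_map /= -(dvdz_pcharf (pchar_Fp pp)) => /divzK; rewrite mulrC => ->.
Qed.

(** As [p] is in [M], so is the kernel of reduction modulo [p], and [M] is the preimage of a prime
    [N] of [F_p[X]]. If [b] were outside [M], some nonzero constant [c] would lie in the Jacobson
    radical modulo [N]; but [c] is a unit, and [w = - c^-1] gives [1 + w c = 0]. *)
Lemma prime_poly_Fp (M : set {poly int}) b (p : nat) : prime p ->
  prime_ideal M -> M (p%:Z)%:P -> jacobson_mod M b -> M b.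
Proof.
move=> pp pM Mp jb; have iM : ideal M by case: pM.
pose pi : {rmorphism {poly int} -> {poly 'F_p}} := map_poly (intr : int -> 'F_p).
have piK G H : pi G = pi H -> M G -> M H.
  move=> E MG; have /int_polyP[//|D DE] : pi (G - H) = 0.
    by rewrite rmorphB /= E subrr.
  have -> : H = G - (G - H) by rewrite opprB addrC subrK.
  by apply: idealB => //; rewrite DE; apply: idealMr.
have pi_surj (g : {poly 'F_p}) : exists G, pi G = g.
  exists (map_poly (fun x : 'F_p => (x : nat)%:Z) g).
  by apply/polyP => i; rewrite !coef_map_id0 // [LHS]natr_Zp.
pose N := pi @` M.
have piM G : N (pi G) -> M G by move=> [H MH /piK]; apply.
have pN : prime_ideal N.
  split.
  - apply: comm_ideal.
    + by exists 0; [case: iM|rewrite rmorph0].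
    + move=> _ _ [G MG <-] [H MH <-].
      by exists (G + H); [apply: idealD|rewrite rmorphD].
    + move=> r _ [G MG <-]; have [H <-] := pi_surj r.
      by exists (H * G); [apply: idealMl|rewrite rmorphM].
  - by rewrite -(rmorph1 pi) => /piM; case: pM.
  - move=> x y; have [G <-] := pi_surj x; have [H <-] := pi_surj y.
    rewrite -rmorphM => /piM; case: pM => _ _ /[apply] -[MG|MH].
      by left; exists G.
    by right; exists H.
have Nk (c : 'F_p) : N c%:P -> c = 0.
  move=> Nc; apply/eqP/negPn/negP => c0; case: pN => iN + _; apply.
  by rewrite -[1]/(1%:P) -(mulVf c0) polyCM; apply: idealMl.
have jN : jacobson_mod N (pi b).
  move=> w; have [W <-] := pi_surj w; have [c Mc] := jb W; exists (pi c).
  by exists ((1 + W * b) * c - 1) => //; rewrite rmorphB !(rmorphM, rmorphD) rmorph1.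
apply: contrapT => nMb; have nNb : ~ N (pi b) by move=> /piM.
have [c c0 jc] := prime_poly_const_jacobson pN Nk nNb jN.
have [v] := jc (- c^-1%:P).
have -> : 1 + - c^-1%:P * c%:P = 0 by rewrite mulNr -polyCM mulVf // subrr.
rewrite mul0r sub0r -polyCN => /Nk /eqP; by rewrite oppr_eq0 oner_eq0.
Qed.

(** It suffices that [b] lies in every prime ideal above [K]. Such a prime either meets the
    constants in 0 only or, by factoring a nonzero constant in it, contains a prime number. *)
Lemma jacobson_int_poly (K : set {poly int}) b :
  ideal K -> jacobson_mod K b -> exists n, K (b ^+ n).
Proof.
move=> iK jb; apply: contrapT => /forallNP Kb.
have [M [pM KM nMb]] := exists_prime_ideal iK Kb.
have jM : jacobson_mod M b by move=> w; have [c /KM] := jb w; exists c.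
have [iM M1 Mmul] := pM.
apply: nMb; have [Mk|] := pselect (forall c, M c%:P -> c = 0).
  exact: prime_poly_int.
move=> /existsNP[c /not_implyP[Mc /eqP c0]].
suff [p pp Mp] : exists2 p : nat, prime p & M (p%:Z)%:P by exact: prime_poly_Fp Mp jM.
have Mabs : M (`|c|%N%:Z)%:P.
  have [E|E] : c = `|c|%N%:Z \/ c = - `|c|%N%:Z by lia.
    by rewrite -E.
  by rewrite -[_%:Z]opprK -E polyCN; apply: idealN.
have : (0 < `|c|)%N by lia.
move: `|c|%N Mabs => n Mn n0 {c Mc c0}.
have [m] := ubnP n; elim: m => // m IHm in n Mn n0 *; rewrite ltnS => nm.
have n1 : (1 < n)%N.
  by rewrite ltn_neqAle n0 andbT; apply/eqP => n1; rewrite -n1 in Mn.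
have pp := pdiv_prime n1.
have E : n = (pdiv n * (n %/ pdiv n))%N by rewrite mulnC divnK // pdiv_dvd.
move: (Mn); rewrite E PoszM polyCM => /Mmul[Mp|]; first by exists (pdiv n).
move=> /IHm; apply.
  by rewrite divn_gt0 ?pdiv_gt0 // pdiv_leq.
by apply: leq_trans nm; rewrite ltn_Pdiv // prime_gt1.
Qed.

(** * Radical rings with a chain condition *)

Definition acc T (C : set T -> Prop) : Prop :=
  ~ exists H : nat -> set T, (forall n, C (H n)) /\ (forall n, H n `<` H n.+1).

Lemma acc_stationary T (C : set T -> Prop) (H : nat -> set T) : acc C ->
  (forall n, C (H n)) -> (forall n, H n `<=` H n.+1) ->
  exists n, H n.+1 `<=` H n.
Proof.
move=> aC CH Hle; apply: contrapT => /forallNP nE.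
by apply: aC; exists H; split=> // n; split.
Qed.

Lemma acc_maximal T (C F : set T -> Prop) X0 : acc C -> (forall X, F X -> C X) ->
  F X0 -> exists2 X, F X & forall Y, F Y -> X `<=` Y -> Y `<=` X.
Proof.
move=> aC FC FX0; apply: contrapT => nE.
have step (X : {X | F X}) : exists Y : {X | F X}, sval X `<` sval Y.
  case: X => X FX /=; apply: contrapT => nY; apply: nE; exists X => // Y FY XY.
  apply: contrapT => YX; apply: nY; exists (exist _ Y FY); split=> //.
have [f fP] := choice step.
apply: aC; exists (fun n => sval (iter n f (exist _ X0 FX0))); split=> n.
  by case: (iter _ _ _) => X /= /FC.
by rewrite iterS; apply: fP.
Qed.

Definition add_subgroup (S : pzRingType) (H : set S) : Prop :=
  H 0 /\ forall x y, H x -> H y -> H (x - y).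

(** Inverses for the circle operation [x + y + x * y], which is multiplication of [1 + x] and
    [1 + y]. They form a relation because an element of [S] need not have one. *)
Definition circ_inverse (S : pzRingType) (x y : S) : Prop :=
  (1 + x) * (1 + y) = 1 /\ (1 + y) * (1 + x) = 1.

Definition circ_subgroup (S : pzRingType) (H : set S) : Prop :=
  [/\ H 0, forall x y, H x -> H y -> H (x + y + x * y)
    & forall x y, circ_inverse x y -> H x -> H y].

Lemma add_subgroupD (S : pzRingType) (H : set S) x y :
  add_subgroup H -> H x -> H y -> H (x + y).
Proof.
move=> [H0 HB] Hx Hy; rewrite -[y]opprK -[- y]sub0r.
by apply: (HB) => //; apply: (HB).
Qed.

Lemma one_add_circ (S : pzRingType) (x y : S) :
  (1 + x) * (1 + y) = 1 + (x + y + x * y).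
Proof.
by rewrite mulrDl mul1r mulrDr mulr1 -addrA; congr (1 + _); rewrite addrCA addrA.
Qed.

Lemma circ_inverseE (S : pzRingType) (x y : S) :
  circ_inverse x y -> y = - (x + x * y).
Proof.
case=> + _; rewrite one_add_circ -[RHS]addr0 => /addrI /eqP.
by rewrite addrAC addrC addr_eq0 => /eqP.
Qed.

Lemma circ_inverse_uniq (S : pzRingType) (x y z : S) :
  circ_inverse x y -> circ_inverse x z -> y = z.
Proof.
move=> [xy _] [_ zx]; apply: (@addrI _ 1); have := mulrA (1 + z) (1 + x) (1 + y).
by rewrite xy zx mulr1 mul1r.
Qed.

Lemma circ_inverseM (S : pzRingType) (x y x' y' : S) :
  circ_inverse x x' -> circ_inverse y y' ->
  circ_inverse (x + y + x * y) (y' + x' + y' * x').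
Proof.
move=> [xx' x'x] [yy' y'y]; rewrite /circ_inverse -!one_add_circ; split.
  by rewrite mulrA -(mulrA (1 + x)) yy' mulr1.
by rewrite mulrA -(mulrA (1 + y')) x'x mulr1.
Qed.

Section RadicalRing.
Variables (S : nzRingType) (R : set S).
Hypotheses (iR : ideal R).
Hypothesis R_inv : forall x, R x -> exists2 y, R y & circ_inverse x y.

Definition within (C : set S -> Prop) (H : set S) : Prop := H `<=` R /\ C H.

Definition right_ideal (L : set S) : Prop :=
  add_subgroup L /\ forall x r, L x -> R r -> L (x * r).

Hypothesis R_acc : acc (within (@add_subgroup S)) \/ acc (within (@circ_subgroup S)).

(** A right ideal inside [R] is also a circle subgroup: the circle inverse [y] of [x] lies in [R]
    and equals [- (x + x * y)]. Hence either alternative of [R_acc] applies. *)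
Lemma acc_right_ideal : acc (within right_ideal).
Proof.
move=> [H [HR Hlt]]; case: R_acc => a; apply: a; exists H; split=> // n;
  have [HnR [aH Hr]] := HR n; split=> //.
split.
- by case: aH.
- move=> x y Hx Hy; apply: add_subgroupD => //; first exact: add_subgroupD.
  by apply: Hr => //; apply: HnR.
- move=> x y xy Hx; have [z Rz xz] := R_inv (HnR _ Hx).
  have yz : y = z by apply: circ_inverse_uniq xy _.
  rewrite (circ_inverseE xy) -sub0r yz; have [H0 HB] := aH; apply: HB => //.
  by apply: add_subgroupD => //; apply: Hr.
Qed.

(** * Nilness of [R], through the subring [Z[x]] generated by one element *)

Section Nil.
Variables (x : S) (Rx : R x).

Let ev : {rmorphism {poly int} -> S} :=
  horner_morph (fun n => commr_int x n : GRing.comm x (n%:~R)).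

Let evX : ev 'X = x. Proof. exact: horner_morphX. Qed.

Let ev_comm f g : ev f * ev g = ev g * ev f.
Proof. by rewrite -!rmorphM mulrC. Qed.

Let evR f : R (ev ('X * f)).
Proof. by rewrite rmorphM /= evX; apply: idealMr. Qed.

(** [X g] lies in the Jacobson radical of [Z[X]] modulo the kernel of [ev], so [x * ev g] is
    nilpotent. The factor [ev g] is cancelled in [S]; its inverse [h] need not belong to [Z[x]]. *)
Lemma nilpotent_of_units g : (exists h, ev g * h = 1) ->
  (forall w, exists c, ev ((1 + w * ('X * g)) * c) = 1) ->
  exists n, x ^+ n = 0.
Proof.
move=> [h gh] U.
have [|w|n] := @jacobson_int_poly [set f | ev f = 0] ('X * g).
- apply: comm_ideal => /= [|y z y0 z0|r y y0].
  + by rewrite rmorph0.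
  + by rewrite rmorphD /= y0 z0 addr0.
  + by rewrite rmorphM /= y0 mulr0.
- by have [c E] := U w; exists c => /=; rewrite rmorphB /= E rmorph1 subrr.
rewrite /= rmorphXn rmorphM /= evX => E; exists n.
have xg : GRing.comm x (ev g) by rewrite -evX; apply: ev_comm.
have hn : ev g ^+ n * h ^+ n = 1.
  elim: n {E} => [|n IHn]; first by rewrite !expr0 mulr1.
  by rewrite exprSr exprS mulrA -(mulrA _ (ev g)) gh mulr1.
by rewrite -[x ^+ n]mulr1 -hn mulrA -exprMn_comm // E mul0r.
Qed.

(* The elements z of R with u^n z in Z[x], where u = 1 + ev f, form an ascending
   chain, whose stationarity puts the inverse of u in Z[x]. *)
Lemma add_inverse_integral f y : acc (within (@add_subgroup S)) ->
  R y -> circ_inverse (ev f) y -> exists c, y = ev c.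
Proof.
move=> aS Ry [uy yu']; set u := 1 + ev f in uy yu'.
have uE : u = ev (1 + f) by rewrite rmorphD rmorph1.
have uyE : u * y = 1 - u by rewrite -uy mulrDr mulr1 addrC addKr.
pose H n := [set z | R z /\ exists c, u ^+ n * z = ev c].
have [n|n z [Rz [c E]]|n /(_ (y ^+ n.+1)) Hn] := acc_stationary aS (H := H).
- split; first by move=> z [].
  split; first by split; [case: iR|exists 0; rewrite mulr0 rmorph0].
  move=> z t [Rz [c E]] [Rt [d F]]; split; first exact: idealB.
  by exists (c - d); rewrite mulrBr E F rmorphB.
- by split=> //; exists ((1 + f) * c); rewrite exprS -mulrA E rmorphM uE.
have yu : GRing.comm y u.
  by rewrite /GRing.comm uyE -yu' mulrDl mul1r addrC addKr.
have upow k : u ^+ k * y ^+ k = (1 - u) ^+ k.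
  by rewrite -exprMn_comm ?uyE //; apply: commr_sym.
(* [u^(n+1) y^(n+1) = (1 - u)^(n+1)] is in [Z[x]]; stationarity puts [u^n y^(n+1) = (1 - u)^n y]
   there too. *)
have {Hn} [] : H n (y ^+ n.+1).
  apply: Hn; split; first by rewrite exprSr; apply: idealMl.
  by exists ((- f) ^+ n.+1); rewrite upow rmorphXn uE rmorphD rmorph1 opprD addNKr rmorphN.
move=> _ [c]; rewrite exprSr mulrA upow.
have E1 : 1 - u = ev (- f) by rewrite uE rmorphD rmorph1 opprD addNKr rmorphN.
(* Since [u y = 1 - u], one has [(1 - u)^n y = (1 - u)^(n+1) y + (1 - u)^(n+1)], which removes the
   factors in front of [y] one by one. *)
elim: n c => [|n IHn] c; first by rewrite expr0 mul1r; exists c.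
move=> E; apply: (IHn (c + (- f) ^+ n.+1)).
rewrite rmorphD /= -E rmorphXn /= -E1 !exprSr -!mulrA.
by rewrite [in RHS]mulrBl mul1r uyE mulrBr mulrDr addrNK.
Qed.

Lemma nilpotent_of_add : acc (within (@add_subgroup S)) -> exists n, x ^+ n = 0.
Proof.
move=> aS; apply: (@nilpotent_of_units 1); first by exists 1; rewrite rmorph1 mulr1.
move=> w; have [y Ry xy] : exists2 y, R y & circ_inverse (ev (w * ('X * 1))) y.
  by apply: R_inv; rewrite mulrCA; apply: evR.
have [c yE] := add_inverse_integral aS Ry xy; exists (1 + c).
by rewrite rmorphM !rmorphD !rmorph1 -yE; case: xy.
Qed.

(* Euclid's argument: if [1 + w X g] is never a unit of [Z[x]], the products of
   such elements generate infinitely many independent circle units. *)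
Lemma circ_units : acc (within (@circ_subgroup S)) ->
  exists2 g, exists h, ev g * h = 1 &
    forall w, exists c, ev ((1 + w * ('X * g)) * c) = 1.
Proof.
move=> aS; apply: contrapT => nE.
have step (g : {poly int}) : exists w, (exists h, ev g * h = 1) ->
    forall c, ev ((1 + w * ('X * g)) * c) <> 1.
  apply: contrapT => nw.
  have gE : exists h, ev g * h = 1.
    by apply: contrapT => ng; apply: nw; exists 0 => /ng.
  apply: nE; exists g => // w; apply: contrapT => /forallNP nc.
  by apply: nw; exists w => _ c; exact: nc.
have [w wP] := choice step.
pose z g := 1 + w g * ('X * g).
have Rz g : R (ev (z g) - 1).
  by rewrite /z rmorphD rmorph1 addrC addKr mulrCA; apply: evR.
pose G n := iter n (fun g => g * z g) 1.
have z_inv g : exists2 y, R y & circ_inverse (ev (z g) - 1) y by apply: R_inv.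
have G_inv n : exists h, ev (G n) * h = 1.
  elim: n => [|n [h IHn]]; first by exists 1; rewrite rmorph1 mulr1.
  have [y _ []] := z_inv (G n); rewrite addrC subrK => zy _.
  by exists ((1 + y) * h); rewrite /= rmorphM -mulrA (mulrA (ev (z _))) zy mul1r.
(* [1 + y] lies in the localization of [Z[x]] at the powers of [G n], so [H n] is a group of units
   of that localization. The next factor [z (G n)] becomes a unit at stage [n.+1]; stationarity
   makes it one at stage [n]. *)
pose U n (y : S) := exists k c, (1 + y) * ev (G n ^+ k) = ev c.
pose H n := [set y | [/\ R y, U n y &
  exists y', [/\ R y', circ_inverse y y' & U n y']]].
have Ucirc n y t : U n y -> U n t -> U n (y + t + y * t).
  move=> [k [c E]] [l [d F]]; exists (l + k)%N, (c * d).
  rewrite -one_add_circ exprD (rmorphM ev (G n ^+ l)) /= -(mulrA (1 + y)) (mulrA (1 + t)) F.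
  by rewrite ev_comm mulrA E -rmorphM.
have US n y : U n y -> U n.+1 y.
  move=> [k [c E]]; exists k, (c * z (G n) ^+ k).
  by rewrite /= exprMn !(rmorphM ev) /= mulrA E.
have [n|n y [Ry Uy [y' [Ry' yy' Uy']]]|n HSn] := acc_stationary aS (H := H).
- split; first by move=> y [].
  have U0 : U n 0 by exists 0%N, 1; rewrite addr0 mul1r.
  split.
  + have R0 : R 0 by case: iR.
    by split=> //; exists 0; split=> //; rewrite /circ_inverse addr0 mulr1.
  + move=> y t [Ry Uy [y' [Ry' yy' Uy']]] [Rt Ut [t' [Rt' tt' Ut']]].
    have RC a b : R a -> R b -> R (a + b + a * b).
      by move=> Ra Rb; apply: idealD => //; [apply: idealD|apply: idealMl].
    split; [exact: RC|exact: Ucirc|exists (t' + y' + t' * y')].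
    by split; [exact: RC|exact: circ_inverseM|exact: Ucirc].
  + move=> y t yt [Ry Uy [y' [Ry' yy' Uy']]].
    rewrite (circ_inverse_uniq yt yy'); split=> //.
    by exists y; split=> //; case: yy'.
- by split; [|apply: US|exists y'; split=> //; apply: US].
have [y Ry zy] := z_inv (G n).
have {HSn} [] : H n (ev (z (G n)) - 1).
  apply: HSn; split=> //; first by exists 0%N, (z (G n)); rewrite expr0 rmorph1 mulr1 addrC subrK.
  exists y; split=> //; exists 1%N, (G n).
  case: zy; rewrite addrC subrK => _ zy.
  by rewrite expr1 /= mulrC rmorphM mulrA zy mul1r.
move=> _ _ [y' [_ [+ _] [k [c E]]]]; rewrite addrC subrK => zy'.
have zc : ev (z (G n) * c) = ev (G n ^+ k).
  by rewrite rmorphM -E mulrA zy' mul1r.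
(* [z (G n)] divides [G n ^+ k] in [Z[x]], hence also [(1 - z (G n))^k], as [1 - z (G n)] is a
   multiple of [G n]. So it divides 1, against the choice of [w]. *)
have [q zq] : exists q, 1 = z (G n) * q + (1 - z (G n)) ^+ k.
  elim: k {E zc} => [|k [q IHk]]; first by exists 0; rewrite mulr0 add0r.
  exists (q + (1 - z (G n)) ^+ k); rewrite [LHS]IHk exprS; ring.
apply: (wP (G n) (G_inv n) (q + (- (w (G n) * 'X)) ^+ k * c)).
rewrite -/(z (G n)) mulrDr rmorphD mulrCA (rmorphM _ (_ ^+ k)) zc -!rmorphM -exprMn.
rewrite -rmorphD -(rmorph1 ev); congr (ev _); rewrite [RHS]zq; congr (_ + _ ^+ _).
by rewrite /z; ring.
Qed.

Lemma nilpotent_of_circ : acc (within (@circ_subgroup S)) ->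
  exists n, x ^+ n = 0.
Proof. by move=> /circ_units[g ge gU]; apply: nilpotent_of_units ge gU. Qed.

Lemma radical_nil : exists n, x ^+ n = 0.
Proof. by case: R_acc => [/nilpotent_of_add|/nilpotent_of_circ]. Qed.

End Nil.
(* The elements z with z R^n inside J. *)
Fixpoint annih (J : set S) (n : nat) : set S :=
  if n is m.+1 then [set z | R z /\ forall r, R r -> annih J m (z * r)] else J.

Lemma annih_comp J K m n : J `<=` annih K m -> annih J n `<=` annih K (n + m).
Proof.
move=> JK; elim: n => [//|n IHn] z [Rz zr]; split=> // r Rr.
by apply: IHn; apply: zr.
Qed.

(* Utumi's argument: a maximal right annihilator modulo [J] is that of an
   element [a] with [a R a] inside [J]. *)
Lemma exists_annihilating_element (J : set S) : ideal J -> J `<=` R ->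
  ~ R `<=` J -> exists a, [/\ R a, ~ J a & forall x, R x -> J (a * x * a)].
Proof.
move=> iJ JR nRJ; have [a0 [Ra0 nJa0]] : exists a, R a /\ ~ J a.
  by apply: contrapT => /forallNP H; apply: nRJ => a Ra; have /not_andP[|/contrapT] := H a.
pose r a := [set y | R y /\ J (a * y)].
pose F (X : set S) := exists a, [/\ R a, ~ J a & X = r a].
have [|||_ [a [Ra nJa ->]] amax] := @acc_maximal _ (within right_ideal) F (r a0).
- exact: acc_right_ideal.
- move=> _ [a [Ra nJa ->]]; split; first by move=> y [].
  split; last first.
    by move=> x y [Rx Jx] Ry; split; [apply: idealMl|rewrite mulrA; apply: idealMr].
  split; first by split; [case: iR|rewrite mulr0; case: iJ].
  by move=> x y [Rx Jx] [Ry Jy]; split; [|rewrite mulrBr]; apply: idealB.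
- by exists a0.
exists a; split=> // x Rx.
have Rax : R (a * x) by apply: idealMl.
have [n nax] := radical_nil Rax.
have : J ((a * x) ^+ n * a) by rewrite nax mul0r; case: iJ.
elim: n {nax} => [|n IHn]; first by rewrite mul1r.
have [//|nJn Jn] := pselect (J ((a * x) ^+ n * a)); first by move/IHn.
(* [x a] is in the right annihilator of [(a x)^n a], which contains that of [a] and, by maximality,
   equals it. *)
have [|y [Ry Jy]||_] := amax (r ((a * x) ^+ n * a)) _ _ (x * a).
- by exists ((a * x) ^+ n * a); split=> //; apply: idealMl.
- by split=> //; rewrite -mulrA; apply: idealMl.
- by split; [apply: idealMl|rewrite !mulrA -(mulrA (_ ^+ n)) -exprSr].
by rewrite mulrA.
Qed.

(** Let [J] be maximal among the ideals modulo which [R] is not nilpotent, and let [a R a] be inside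
    [J] with [a] outside. The ideals [K1 = {k | k R a in J}] and [K2 = {k | K1 R k in J}] contain
    [J] and [a], so each contains a power of [R]. As [K1 R K2] is inside [J], so is a power of
    [R]. *)
Lemma radical_nilpotent : exists n, R `<=` annih [set 0] n.
Proof.
pose small J := exists n, R `<=` annih J n.
apply: contrapT => nsmall0.
pose F (J : set S) := [/\ ideal J, J `<=` R & ~ small J].
have [|||J [iJ JR nsJ] Jmax] := @acc_maximal _ (within right_ideal) F [set 0].
- exact: acc_right_ideal.
- move=> J [iJ JR _]; split=> //; split; last by move=> x r Jx _; apply: idealMr.
  by split; [case: iJ|move=> x y; apply: idealB].
- split=> //; last by move=> _ ->; case: iR.
  by split=> //= [x y -> ->|r x ->]; rewrite ?addr0 ?mulr0 ?mul0r.
have nRJ : ~ R `<=` J by move=> RJ; apply: nsJ; exists 0%N.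
have [a [Ra nJa aRa]] := exists_annihilating_element iJ JR nRJ.
have Jsmall K : ideal K -> K `<=` R -> J `<=` K -> K a -> small K.
  move=> iK KR JK Ka; apply: contrapT => nsK.
  by apply: nJa; apply: (Jmax K).
have [||||n RK1] := @Jsmall [set k | R k /\ forall r, R r -> J (k * r * a)].
- split=> [|x y [Rx Jx] [Ry Jy]|s x [Rx Jx]].
  + by split=> [|r _]; [case: iR|rewrite !mul0r; case: iJ].
  + split=> [|r Rr]; first exact: idealD.
    by rewrite !mulrDl; apply: idealD => //; [apply: Jx|apply: Jy].
  + (split; split=> [|r Rr]); [exact: idealMl| |exact: idealMr|].
      by rewrite -!mulrA; apply: idealMl => //; rewrite mulrA; apply: Jx.
    by rewrite -(mulrA x); apply: Jx; apply: idealMl.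
- by move=> x [].
- move=> x Jx; split=> [|r Rr]; first exact: JR.
  by apply: idealMr => //; apply: idealMr.
- by split.
set K1 := (X in annih X) in RK1.
have [||||m RK2] := @Jsmall [set k | R k /\
    forall k1 y, K1 k1 -> R y -> J (k1 * y * k)].
- split=> [|x y [Rx Jx] [Ry Jy]|s x [Rx Jx]].
  + by split=> [|k y _ _]; [case: iR|rewrite mulr0; case: iJ].
  + split=> [|k t Kk Rt]; first exact: idealD.
    by rewrite mulrDr; apply: idealD => //; [apply: Jx|apply: Jy].
  + (split; split=> [|k t Kk Rt]); [exact: idealMl| |exact: idealMr|].
      by rewrite mulrA -(mulrA k); apply: Jx => //; apply: idealMr.
    by rewrite mulrA; apply: idealMr => //; apply: Jx.
- by move=> x [].
- by move=> x Jx; split=> [|k t _ _]; [exact: JR|exact: idealMl].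
- by split=> // k t [_ Jk] Rt; apply: Jk.
set K2 := (X in annih X) in RK2.
have K12 z q : annih K2 q z -> forall k y, K1 k -> R y -> annih J q (k * y * z).
  elim: q z => [|q IHq] z [Rz zP] k y Kk Ry; first exact: zP.
  split=> [|r Rr]; first exact: idealMl.
  by rewrite -mulrA; apply: IHq => //; apply: zP.
(* Beyond the [n] factors leading into [K1]: one factor between [K1] and [K2], then one element of
   [R] and the [m] factors that take it into [K2]. *)
apply: nsJ; exists (n + m.+2)%N; apply: (subset_trans RK1); apply: annih_comp.
move=> k Kk; split=> [|y Ry]; first by case: Kk.
split=> [|z Rz]; first exact: idealMl.
by apply: K12 => //; apply: RK2.
Qed.

Lemma annih0_add_subgroup n : add_subgroup (annih [set 0] n).
Proof.
elim: n => [|n [Z0 ZB]]; first by split=> //= x y -> ->; rewrite subr0.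
split; first by split=> [|r _]; [case: iR|rewrite mul0r].
move=> x y [Rx xZ] [Ry yZ]; split=> [|r Rr]; first exact: idealB.
by rewrite mulrBl; apply: ZB; [apply: xZ|apply: yZ].
Qed.

Lemma annih0Ml n s z : annih [set 0] n z -> annih [set 0] n (s * z).
Proof.
elim: n z => [|n IHn] z; first by move=> /= ->; rewrite mulr0.
move=> [Rz zZ]; split=> [|r Rr]; first exact: idealMl.
by rewrite -mulrA; apply: IHn; apply: zZ.
Qed.

Lemma annih0_circ_subgroup n : circ_subgroup (annih [set 0] n).
Proof.
have aZ := annih0_add_subgroup n; have [Z0 ZB] := aZ.
split=> // [x y Zx Zy|x y [_ yx] Zx].
  by do !apply: add_subgroupD => //; apply: annih0Ml.
have -> : y = 0 - (1 + y) * x.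
  apply/eqP; rewrite sub0r -addr_eq0; apply/eqP/(@addrI _ 1).
  by rewrite addrA -[X in X + _]mulr1 -mulrDr yx addr0.
by apply: ZB => //; apply: annih0Ml.
Qed.

(** Solving for [c] gives a left multiple of [x * y - y * x], and both products lie one step
    lower. *)
Lemma annih0_circ_commutator n x y c : annih [set 0] n.+1 x ->
  annih [set 0] n.+1 y -> (1 + y) * (1 + x) * (1 + c) = (1 + x) * (1 + y) ->
  annih [set 0] n c.
Proof.
move=> [Rx Zx] [Ry Zy] E.
have [x' _ [_ x'x]] := R_inv Rx; have [y' _ [_ y'y]] := R_inv Ry.
have -> : c = (1 + x') * (1 + y') * (x * y - y * x).
  have <- : (1 + y) * (1 + x) * c = x * y - y * x.
    have -> : c = 1 + c - 1 by rewrite addrC addKr.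
    rewrite mulrBr E mulr1 !one_add_circ opprD addrACA subrr add0r.
    by rewrite (addrC y) opprD addrACA subrr add0r.
  by rewrite !mulrA -(mulrA (1 + x')) y'y mulr1 x'x mul1r.
apply: annih0Ml; have [_ ZB] := annih0_add_subgroup n.
by apply: ZB; [apply: Zx|apply: Zy].
Qed.

End RadicalRing.

(** * Embedding a ring without unit in a unital ring *)

Lemma zmod_morphismMz (U V : zmodType) (f : U -> V) n x :
  (forall x y, f (x - y) = f x - f y) -> f (x *~ n) = f x *~ n.
Proof.
move=> fB; pose F : {additive U -> V} :=
  HB.pack f (GRing.isZmodMorphism.Build U V f fB).
exact: (raddfMz F).
Qed.

Section Dorroh.
Variables (V : zmodType) (mul : V -> V -> V).
Hypotheses (mulA : associative mul).
Hypotheses (mulDl : left_distributive mul +%R) (mulDr : right_distributive mul +%R).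

Let mulBl x y z : mul (x - y) z = mul x z - mul y z.
Proof. by apply/eqP; rewrite eq_sym subr_eq -mulDl subrK. Qed.

Let mulBr x y z : mul z (x - y) = mul z x - mul z y.
Proof. by apply/eqP; rewrite eq_sym subr_eq -mulDr subrK. Qed.

Let mulzl n x y : mul (x *~ n) y = mul x y *~ n.
Proof. by rewrite (zmod_morphismMz (f := mul^~ y)). Qed.

Let mulzr n x y : mul x (y *~ n) = mul x y *~ n.
Proof. by rewrite (zmod_morphismMz (f := mul x)). Qed.

(** The pair [(n, x)] of [int * V] plays the role of the formal sum [n + x]. *)
Lemma dorroh_extension : exists (S : nzRingType) (j : V -> S),
  [/\ injective j, forall x y, j (x + y) = j x + j y,
      forall x y, j (mul x y) = j x * j y & ideal (range j)].
Proof.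
pose D : zmodType := (int * V)%type.
pose dmul (a b : D) : D :=
  (a.1 * b.1, a.2 *~ b.1 + b.2 *~ a.1 + mul a.2 b.2).
have mul0 x : mul 0 x = 0 by have := mulBl 0 0 x; rewrite !subrr.
have mulr0' x : mul x 0 = 0 by have := mulBr 0 0 x; rewrite !subrr.
have dmulA : associative dmul.
  move=> [a x] [b y] [c z]; rewrite /dmul /=; congr pair; first exact: mulrA.
  rewrite !mulrzDl !mulDl !mulDr !mulzl !mulzr !mulA -!mulrzA.
  rewrite (mulrC c a) (mulrC b a).
  have perm (X Y Z W P Q T : V) :
      X + (Y + Z + W) + (P + Q + T) = X + Y + P + Z + (Q + W + T).
    by rewrite [LHS](AC (1*3*3) (1*2*5*3*(6*4*7))).
  exact: perm.
have dmul1 : left_id (1, 0) dmul.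
  by move=> [a x]; rewrite /dmul /= mul1r mul0rz add0r mul0 addr0 mulr1z.
have dmul1r : right_id (1, 0) dmul.
  by move=> [a x]; rewrite /dmul /= mulr1 mul0rz addr0 mulr0' addr0 mulr1z.
have dmulDl : left_distributive dmul +%R.
  move=> [a x] [b y] [c z]; rewrite /dmul /=; congr pair; first exact: mulrDl.
  by rewrite /= mulrzDl mulrzDr mulDl [RHS]addrACA [X in _ = X + _]addrACA.
have dmulDr : right_distributive dmul +%R.
  move=> [a x] [b y] [c z]; rewrite /dmul /=; congr pair; first exact: mulrDr.
  by rewrite /= mulrzDl mulrzDr mulDr [RHS]addrACA [X in _ = X + _]addrACA.
have d1 : (1, 0) != 0 :> D by [].
pose S : nzRingType := HB.pack (int * V)%type
  (GRing.Zmodule_isNzRing.Build D dmulA dmul1 dmul1r dmulDl dmulDr d1).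
exists S, (fun x => (0, x) : S); split=> [x y []//|x y|x y|].
- by congr pair; rewrite /= addr0.
- by congr pair; rewrite /= ?mulr0 // !mulr0z !add0r.
- split; first by exists 0.
  + by move=> _ _ [x _ <-] [y _ <-]; exists (x + y) => //; congr pair; rewrite /= addr0.
  + move=> [n r] _ [x _ <-]; split.
      by exists (x *~ n + mul r x) => //; congr pair; rewrite /= ?mulr0 // mulr0z add0r.
    by exists (x *~ n + mul x r) => //; congr pair; rewrite /= ?mul0r // mulr0z addr0.
Qed.
End Dorroh.

(** * Groups given by a [groupLaw] *)

Section GroupLaw.
Variables (T : Type) (G : groupLaw T).
Implicit Types (x y z : T) (X Y H : set T).

Lemma gop_invr x : gop G x (ginv G x) = gid G.
Proof.
rewrite -[LHS](gop_idl G) -{1}(gop_invl G (ginv G x)) -gopA.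
by rewrite (gopA G _ x) gop_invl gop_idl gop_invl.
Qed.

Lemma gop_idr x : gop G x (gid G) = x.
Proof. by rewrite -(gop_invl G x) gopA gop_invr gop_idl. Qed.

Lemma gopKl x y : gop G (ginv G x) (gop G x y) = y.
Proof. by rewrite gopA gop_invl gop_idl. Qed.

Lemma gopVKl x y : gop G x (gop G (ginv G x) y) = y.
Proof. by rewrite gopA gop_invr gop_idl. Qed.

Lemma gop_injl x y z : gop G x y = gop G x z -> y = z.
Proof. by move=> E; rewrite -(gopKl x y) E gopKl. Qed.

Lemma gop_injr x y z : gop G y x = gop G z x -> y = z.
Proof. by move=> E; rewrite -(gop_idr y) -(gop_invr x) gopA E -gopA gop_invr gop_idr. Qed.

Lemma ginvK x : ginv G (ginv G x) = x.
Proof. by apply: (@gop_injl (ginv G x)); rewrite gop_invr gop_invl. Qed.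

Lemma ginv_id : ginv G (gid G) = gid G.
Proof. by rewrite -[LHS](gop_idl G) gop_invr. Qed.

Lemma ginvM x y : ginv G (gop G x y) = gop G (ginv G y) (ginv G x).
Proof.
by apply: (@gop_injl (gop G x y)); rewrite gop_invr -gopA gopVKl gop_invr.
Qed.

Definition gnorm := (ginvM, ginvK, ginv_id, fun x y z => esym (gopA G x y z),
  gopKl, gopVKl, gop_invl G, gop_invr, gop_idl G, gop_idr).

Lemma subgroup_id H : subgroup G H -> H (gid G).
Proof. by case. Qed.

Lemma subgroupM H x y : subgroup G H -> H x -> H y -> H (gop G x y).
Proof. by case=> _ + _; apply. Qed.

Lemma subgroupV H x : subgroup G H -> H x -> H (ginv G x).
Proof. by case=> _ _; apply. Qed.

Lemma generated_subgroup X : subgroup G (generated G X).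
Proof.
split=> [H []|x y Xx Xy H HX|x Xx H HX]; first by case.
  by apply: subgroupM; [case: HX|apply: Xx|apply: Xy].
by apply: subgroupV; [case: HX|apply: Xx].
Qed.

Lemma sub_generated X : X `<=` generated G X.
Proof. exact: sub_gen_smallest. Qed.

Lemma generated_sub X H : subgroup G H -> X `<=` H -> generated G X `<=` H.
Proof. exact: smallest_sub. Qed.

Lemma generated_commute X Y :
  (forall x y, X x -> Y y -> gop G x y = gop G y x) ->
  forall x y, generated G X x -> generated G Y y -> gop G x y = gop G y x.
Proof.
have centP Z : subgroup G [set x | forall z, Z z -> gop G x z = gop G z x].
  split=> [z _|x y xC yC z Zz|x xC z Zz]; first by rewrite gop_idl gop_idr.
    by rewrite -gopA yC // gopA xC // gopA.
  by apply: (@gop_injl x); apply: (@gop_injr x); rewrite !gnorm xC.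
move=> XY x y Xx Yy; apply: (generated_sub (centP (generated G Y))) Xx _ Yy.
move=> {}x Xx /= {}y Yy; apply/esym.
have H : generated G Y `<=` [set z | forall x, X x -> gop G z x = gop G x z].
  by apply: generated_sub (centP X) _ => z Yz t Xt; apply/esym/XY.
exact: H.
Qed.

Definition normal H : Prop :=
  forall x h, H h -> H (gop G (gop G x h) (ginv G x)).

Lemma normal_generated X :
  (forall x h, X h -> generated G X (gop G (gop G x h) (ginv G x))) ->
  normal (generated G X).
Proof.
move=> Xn x h; have gX := generated_subgroup X.
apply: (generated_sub (H := [set h | generated G X (gop G (gop G x h) (ginv G x))])).
  split=> /=; first by rewrite !gnorm; apply: subgroup_id.
    move=> y z yX zX; have := subgroupM gX yX zX; by rewrite !gnorm.
  by move=> y yX; have := subgroupV gX yX; rewrite !gnorm.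
exact: Xn.
Qed.

Lemma derived_series_id n : derived_series G n (gid G).
Proof. by case: n => [//|n]; apply: subgroup_id; apply: generated_subgroup. Qed.

Lemma soluble_of_sub n : derived_series G n `<=` [set gid G] -> soluble_group G.
Proof.
move=> Dn; exists n; apply/seteqP; split=> // x ->; exact: derived_series_id.
Qed.

Lemma derived_series_descent n m (Z : nat -> set T) :
  (forall k, subgroup G (Z k)) ->
  (forall k x y, Z k.+1 x -> Z k.+1 y -> Z k (commutator G x y)) ->
  derived_series G n `<=` Z m -> derived_series G (m + n)%N `<=` Z 0%N.
Proof.
move=> gZ cZ DZ; suff H k : (k <= m)%N -> derived_series G (k + n)%N `<=` Z (m - k)%N.
  by have := H m; rewrite subnn; apply.
elim: k => [|k IHk] km; first by rewrite subn0.
apply: generated_sub => // _ [x Dx [y Dy <-]].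
by apply: cZ; rewrite subnSK //; apply: IHk => //; apply: ltnW.
Qed.

End GroupLaw.

(** [E] stands for a congruence between the two laws modulo a normal subgroup; a relation compatible
    with both laws avoids forming the quotient groups. *)
Lemma derived_series_rel T (G H : groupLaw T) (E : T -> T -> Prop) :
  E (gid G) (gid H) ->
  (forall x y x' y', E x y -> E x' y' -> E (gop G x x') (gop H y y')) ->
  (forall x y, E x y -> E (ginv G x) (ginv H y)) ->
  (forall y, exists x, E x y) ->
  forall n y, derived_series H n y -> exists2 x, derived_series G n x & E x y.
Proof.
move=> E1 EM EV Etot; elim=> [|n IHn] y; first by have [x] := Etot y; exists x.
have gG := generated_subgroup G.
apply: (generated_sub (H := [set y | exists2 x, derived_series G n.+1 x & E x y])).
  split=> [|z t [x Dx Exz] [x' Dx' Ext]|z [x Dx Exz]].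
  - by exists (gid G) => //; apply: derived_series_id.
  - by exists (gop G x x'); [apply: (subgroupM (gG _))|apply: EM].
  - by exists (ginv G x); [apply: (subgroupV (gG _))|apply: EV].
move=> _ [y1 /IHn[x1 Dx1 E1'] [y2 /IHn[x2 Dx2 E2] <-]].
exists (commutator G x1 x2); last by apply: (EM); apply: (EM) => //; apply: EV.
by apply: sub_generated; exists x1 => //; exists x2.
Qed.

Lemma nonunital_ring_embedding T (G : groupLaw T) (P : set T) (mul : T -> T -> T) :
  subgroup G P ->
  (forall x y, P x -> P y -> gop G x y = gop G y x) ->
  (forall x y, P x -> P y -> P (mul x y)) ->
  (forall x y z, P x -> P y -> P z -> mul x (mul y z) = mul (mul x y) z) ->
  (forall x y z, P x -> P y -> P z ->
     mul (gop G x y) z = gop G (mul x z) (mul y z)) ->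
  (forall x y z, P x -> P y -> P z ->
     mul z (gop G x y) = gop G (mul z x) (mul z y)) ->
  exists (S : nzRingType) (j : T -> S),
    [/\ forall x y, P x -> P y -> j x = j y -> x = y,
        forall x y, P x -> P y -> j (gop G x y) = j x + j y,
        forall x y, P x -> P y -> j (mul x y) = j x * j y
      & ideal (j @` P)].
Proof.
move=> gP Pcomm Pmul PmulA PmulDl PmulDr.
pose V0 := {x | P x}.
have eqV (a b : V0) : sval a = sval b -> a = b.
  by case: a b => [x Px] [y Py] /= E; apply: eq_exist.
pose add (a b : V0) : V0 := exist P _ (subgroupM gP (svalP a) (svalP b)).
pose opp (a : V0) : V0 := exist P _ (subgroupV gP (svalP a)).
pose zero : V0 := exist P _ (subgroup_id gP).
have addA : associative add by move=> a b c; apply: eqV; rewrite /= gopA.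
have addC : commutative add by move=> [a Pa] [b Pb]; apply: eqV; apply: Pcomm.
have add0 : left_id zero add by move=> a; apply: eqV; rewrite /= gop_idl.
have addN : left_inverse zero opp add by move=> a; apply: eqV; rewrite /= gop_invl.
pose V1 : choiceType := HB.pack V0 (gen_eqMixin V0) (gen_choiceMixin V0).
pose V : zmodType := HB.pack V0 V1
  (GRing.isZmodule.Build V1 addA addC add0 addN).
pose mulV (a b : V) : V := exist P _ (Pmul _ _ (svalP a) (svalP b)).
have mulVA : associative mulV.
  by move=> [a Pa] [b Pb] [c Pc]; apply: eqV; apply: PmulA.
have mulVDl : left_distributive mulV +%R.
  by move=> [a Pa] [b Pb] [c Pc]; apply: eqV; apply: PmulDl.
have mulVDr : right_distributive mulV +%R.
  by move=> [a Pa] [b Pb] [c Pc]; apply: eqV; apply: PmulDr.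
have [S [j [j_inj jD jM jI]]] := dorroh_extension mulVA mulVDl mulVDr.
(* The value 0 outside [P] is arbitrary: the conclusions concern elements of [P]. *)
pose i x := if pselect (P x) is left Px then j (exist P x Px) else 0.
have iE x (Px : P x) : i x = j (exist P x Px).
  by rewrite /i; case: pselect => // Px'; congr j; apply: eqV.
exists S, i; split=> [x y Px Py|x y Px Py|x y Px Py|].
- by rewrite !iE => /j_inj/(congr1 sval).
- rewrite (iE _ Px) (iE _ Py) (iE _ (subgroupM gP Px Py)).
  by have <- := jD (exist P x Px) (exist P y Py); congr j; apply: eqV.
- rewrite (iE _ Px) (iE _ Py) (iE _ (Pmul _ _ Px Py)).
  by have <- := jM (exist P x Px) (exist P y Py); congr j; apply: eqV.
suff -> : i @` P = range j by [].
apply/seteqP; split=> [_ [x Px <-]|_ [[x Px] _ <-]].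
  by rewrite iE; exists (exist P x Px).
by exists x => //; rewrite iE.
Qed.

(** * Two-sided skew braces *)

Section Brace.
Variables (A : skewBrace) (A2 : two_sided A).
Implicit Types a b c d x y z : A.

Notation G := (sb_add A).
Notation C := (sb_circ A).
Local Notation "a ⊕ b" := (gop G a b) (at level 50, left associativity).
Local Notation "a ⊚ b" := (gop C a b) (at level 40, left associativity).
Local Notation "⊖ a" := (ginv G a) (at level 35, right associativity).
Local Notation "a ⋆ b" := (sb_star a b) (at level 40, left associativity).

(** This is the star operation of the opposite skew brace, in which addition is reversed. *)
Definition sb_opstar a b : A := ⊖ b ⊕ a ⊚ b ⊕ ⊖ a.
Local Notation "a ⋇ b" := (sb_opstar a b) (at level 40, left associativity).

Lemma sb_circE a b : a ⊚ b = a ⊕ a ⋆ b ⊕ b.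
Proof. by rewrite /sb_star !gnorm. Qed.

Lemma sb_id : gid C = gid G.
Proof.
have := sb_distl (gid C) (gid G) (gid G); rewrite !gop_idl gop_idr.
by move=> /(congr1 (ginv G)); rewrite ginvK ginv_id.
Qed.

Definition sb_square : set A := generated G [set a ⋆ b | a in setT & b in setT].
Definition sb_opsquare : set A := generated G [set a ⋇ b | a in setT & b in setT].
Notation P := sb_square.
Notation Q := sb_opsquare.

Lemma sb_square_star a b : P (a ⋆ b).
Proof. by apply: sub_generated; exists a => //; exists b. Qed.

Lemma sb_opsquare_star a b : Q (a ⋇ b).
Proof. by apply: sub_generated; exists a => //; exists b. Qed.

Lemma sb_square_subgroup : subgroup G P. Proof. exact: generated_subgroup. Qed.
Lemma sb_opsquare_subgroup : subgroup G Q. Proof. exact: generated_subgroup. Qed.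
Let gP := sb_square_subgroup.
Let gQ := sb_opsquare_subgroup.

Lemma sb_square_normal : normal G P.
Proof.
apply: normal_generated => b _ [a _ [c _ <-]].
have -> : b ⊕ a ⋆ c ⊕ ⊖ b = ⊖ (a ⋆ b) ⊕ a ⋆ (b ⊕ c).
  by rewrite /sb_star sb_distl !gnorm.
by apply: (subgroupM gP); [apply: (subgroupV gP)|]; apply: sb_square_star.
Qed.

Lemma sb_opsquare_normal : normal G Q.
Proof.
apply: normal_generated => d _ [b _ [c _ <-]].
have -> : d ⊕ b ⋇ c ⊕ ⊖ d = b ⋇ (c ⊕ ⊖ d) ⊕ ⊖ (b ⋇ (⊖ d)).
  by rewrite /sb_opstar sb_distl !gnorm.
by apply: (subgroupM gQ); [|apply: (subgroupV gQ)]; apply: sb_opsquare_star.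
Qed.

(* Compare the two expansions of (a + b)∘(c + d). *)
Lemma sb_star_opstar_comm a b c d : (a ⋆ d) ⊕ (b ⋇ c) = (b ⋇ c) ⊕ (a ⋆ d).
Proof.
have : (a ⊕ b) ⊚ (c ⊕ d) = (a ⊕ b) ⊚ (c ⊕ d) by [].
rewrite {1}sb_distl !A2 !sb_distl !gnorm => /(@gop_injl _ G) E.
apply/esym; apply: (@gop_injr _ G (b ⊚ d)).
rewrite /sb_star /sb_opstar !gnorm.
exact: E.
Qed.

Lemma sb_square_opsquare_comm x y : P x -> Q y -> x ⊕ y = y ⊕ x.
Proof.
apply: generated_commute => _ _ [a _ [d _ <-]] [b _ [c _ <-]].
exact: sb_star_opstar_comm.
Qed.

Lemma sb_square_circ x y x' y' :
  P (x ⊕ ⊖ y) -> P (x' ⊕ ⊖ y') -> P (x ⊕ x' ⊕ ⊖ (y ⊚ y')).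
Proof.
move=> Pxy Pxy'.
have -> : x ⊕ x' ⊕ ⊖ (y ⊚ y') =
    x ⊕ (x' ⊕ ⊖ y' ⊕ ⊖ (y ⋆ y')) ⊕ ⊖ x ⊕ (x ⊕ ⊖ y) by rewrite /sb_star !gnorm.
apply: (subgroupM gP) => //; apply: sb_square_normal; apply: (subgroupM gP) => //.
by apply: (subgroupV gP); apply: sb_square_star.
Qed.

Lemma sb_square_circV x y : P (x ⊕ ⊖ y) -> P (⊖ x ⊕ ⊖ ginv C y).
Proof.
move=> Pxy; have -> : ⊖ x ⊕ ⊖ ginv C y =
    ⊖ x ⊕ ⊖ (x ⊕ ⊖ y) ⊕ ⊖ ⊖ x ⊕ y ⋆ ginv C y.
  by rewrite /sb_star gop_invr sb_id !gnorm.
apply: (subgroupM gP); last exact: sb_square_star.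
by apply: sb_square_normal; apply: (subgroupV gP).
Qed.

(** [Q (x ⊕ y)] says that [x] is [⊖ y] modulo [Q]. There [⊚] is reversed addition, and negation
    turns it back into addition. *)
Lemma sb_opsquare_circ x y x' y' :
  Q (x ⊕ y) -> Q (x' ⊕ y') -> Q (x ⊕ x' ⊕ y ⊚ y').
Proof.
move=> Qxy Qxy'.
have -> : x ⊕ x' ⊕ y ⊚ y' =
    x ⊕ (x' ⊕ y' ⊕ y ⋇ y') ⊕ ⊖ x ⊕ (x ⊕ y) by rewrite /sb_opstar !gnorm.
apply: (subgroupM gQ) => //; apply: sb_opsquare_normal; apply: (subgroupM gQ) => //.
exact: sb_opsquare_star.
Qed.

Lemma sb_opsquare_circV x y : Q (x ⊕ y) -> Q (⊖ x ⊕ ginv C y).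
Proof.
move=> Qxy; have -> : ⊖ x ⊕ ginv C y =
    ⊖ x ⊕ (⊖ (x ⊕ y)) ⊕ ⊖ ⊖ x ⊕ ⊖ (y ⋇ ginv C y).
  by rewrite /sb_opstar gop_invr sb_id !gnorm.
apply: (subgroupM gQ); last by apply: (subgroupV gQ); apply: sb_opsquare_star.
by apply: sb_opsquare_normal; apply: (subgroupV gQ).
Qed.

(** * The radical ring [P ∩ Q] *)

Definition sb_core : set A := P `&` Q.
Notation I := sb_core.

Lemma sb_core_subgroup : subgroup G I.
Proof.
split=> [|x y [Px Qx] [Py Qy]|x [Px Qx]].
- by split; apply: subgroup_id.
- by split; [apply: (subgroupM gP)|apply: (subgroupM gQ)].
- by split; [apply: (subgroupV gP)|apply: (subgroupV gQ)].
Qed.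
Let gI := sb_core_subgroup.

Lemma sb_core_comm x y : I x -> I y -> x ⊕ y = y ⊕ x.
Proof. by move=> [Px _] [_ Qy]; apply: sb_square_opsquare_comm. Qed.

Lemma sb_core_star x y : I x -> I y -> I (x ⋆ y).
Proof.
move=> [Px Qx] [Py Qy]; split; first exact: sb_square_star.
have -> : x ⋆ y = ⊖ x ⊕ y ⊕ x ⋇ y ⊕ x ⊕ ⊖ y by rewrite /sb_star /sb_opstar !gnorm.
apply: (subgroupM gQ _ (subgroupV gQ Qy)); apply: (subgroupM gQ _ Qx).
apply: (subgroupM gQ _ (sb_opsquare_star x y)).
exact: (subgroupM gQ (subgroupV gQ Qx) Qy).
Qed.

Lemma sb_core_starDl x y z : I x -> I y -> I z -> (x ⊕ y) ⋆ z = x ⋆ z ⊕ y ⋆ z.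
Proof.
move=> Ix Iy Iz; apply: (@gop_injl _ G y).
have -> : y ⊕ (x ⊕ y) ⋆ z = x ⋆ z ⊕ y ⊕ y ⋆ z.
  by rewrite /sb_star A2 !gnorm.
by rewrite -(sb_core_comm Iy (sb_core_star Ix Iz)) -gopA.
Qed.

Lemma sb_core_starDr x y z : I x -> I y -> I z -> z ⋆ (x ⊕ y) = z ⋆ x ⊕ z ⋆ y.
Proof.
move=> Ix Iy Iz; apply: (@gop_injr _ G x).
have -> : z ⋆ (x ⊕ y) ⊕ x = z ⋆ x ⊕ (x ⊕ z ⋆ y).
  by rewrite /sb_star sb_distl !gnorm.
by rewrite (sb_core_comm Ix (sb_core_star Iz Iy)) gopA.
Qed.

(** Expanding both sides of the associativity of [⊚] by the two distributive laws gives the same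
    terms except for the triple products. *)
Lemma sb_core_starA x y z : I x -> I y -> I z -> x ⋆ (y ⋆ z) = (x ⋆ y) ⋆ z.
Proof.
move=> Ix Iy Iz.
have Ixy := sb_core_star Ix Iy; have Iyz := sb_core_star Iy Iz.
have Ixz := sb_core_star Ix Iz.
have Ixyz := sb_core_star Ixy Iz; have Ixyz' := sb_core_star Ix Iyz.
have IM := subgroupM gI.
have L : x ⊚ (y ⊚ z) = x ⊕ (x ⋆ y ⊕ (x ⋆ (y ⋆ z) ⊕ (x ⋆ z ⊕ y ⊕ (y ⋆ z ⊕ z)))).
  rewrite (sb_circE x) (sb_circE y) (sb_core_starDr _ Iz Ix) ?(sb_core_starDr Iy) //.
    by rewrite -!gopA.
  exact: IM.
have R : (x ⊚ y) ⊚ z = x ⊕ (x ⋆ y ⊕ ((x ⋆ y) ⋆ z ⊕ (x ⋆ z ⊕ y ⊕ (y ⋆ z ⊕ z)))).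
  rewrite (sb_circE _ z) (sb_circE x) (sb_core_starDl _ Iy Iz) ?(sb_core_starDl Ix) //.
    have E := sb_core_comm Iy (IM _ _ Ixyz Ixz).
    by rewrite (sb_core_comm Ixz Ixyz) -(gopA G (x ⊕ _) y) (gopA G y) E -!gopA.
  exact: IM.
move: (gopA C x y z); rewrite L R.
by move=> /(@gop_injl _ G) /(@gop_injl _ G) /(@gop_injr _ G).
Qed.

Lemma sb_core_circ x y : I x -> I y -> I (x ⊚ y).
Proof.
move=> Ix Iy; rewrite sb_circE.
by do 2![apply: (subgroupM gI) => //]; apply: sb_core_star.
Qed.

Lemma sb_core_circV x : I x -> I (ginv C x).
Proof.
move=> [Px Qx].
split.
  have := sb_square_circV (x := gid G) (y := x); rewrite !gnorm.
  move=> /(_ (subgroupV gP Px))/(subgroupV gP); by rewrite ginvK.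
have := sb_opsquare_circV (x := gid G) (y := x); rewrite !gnorm; exact.
Qed.

Lemma sb_core_circ_subgroup : subgroup C I.
Proof.
by split; [rewrite sb_id; case: gI|exact: sb_core_circ|exact: sb_core_circV].
Qed.

Lemma derived_series_circ_core n :
  derived_series G n = [set gid G] -> derived_series C n `<=` I.
Proof.
move=> Dn y Dy; split.
  have [||||x] := @derived_series_rel A G C (fun x y => P (x ⊕ ⊖ y)) _ _ _ _ n y Dy.
  - by rewrite sb_id gop_invr; apply: subgroup_id.
  - by move=> *; apply: sb_square_circ.
  - by move=> *; apply: sb_square_circV.
  - by move=> z; exists z; rewrite gop_invr; apply: subgroup_id.
  - by rewrite Dn => -> /(subgroupV gP); rewrite !gnorm.
have [||||x] := @derived_series_rel A G C (fun x y => Q (x ⊕ y)) _ _ _ _ n y Dy.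
- by rewrite sb_id gop_idl; apply: subgroup_id.
- by move=> *; apply: sb_opsquare_circ.
- by move=> *; apply: sb_opsquare_circV.
- by move=> z; exists (⊖ z); rewrite gop_invl; apply: subgroup_id.
- by rewrite Dn => ->; rewrite gop_idl.
Qed.

Lemma derived_series_add_core n :
  derived_series C n = [set gid C] -> derived_series G n `<=` I.
Proof.
move=> Dn y Dy; split.
  have [||||x] := @derived_series_rel A C G (fun x y => P (y ⊕ ⊖ x)) _ _ _ _ n y Dy.
  - by rewrite sb_id gop_invr; apply: subgroup_id.
  - by move=> *; apply: sb_square_circ.
  - by move=> *; apply: sb_square_circV.
  - by move=> z; exists z; rewrite gop_invr; apply: subgroup_id.
  - by rewrite Dn => ->; rewrite sb_id !gnorm.
have [||||x] := @derived_series_rel A C G (fun x y => Q (y ⊕ x)) _ _ _ _ n y Dy.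
- by rewrite sb_id gop_idl; apply: subgroup_id.
- by move=> *; apply: sb_opsquare_circ.
- by move=> *; apply: sb_opsquare_circV.
- by move=> z; exists (⊖ z); rewrite gop_invr; apply: subgroup_id.
- by rewrite Dn => ->; rewrite sb_id gop_idr.
Qed.

Lemma soluble_add_of_circ : soluble_group C -> soluble_group G.
Proof.
move=> [n /derived_series_add_core DI].
apply: (@soluble_of_sub _ G n.+1); apply: generated_sub.
  split=> //= [x y -> ->|x ->]; first by rewrite gop_idl.
  by rewrite ginv_id.
move=> _ [x /DI Ix [y /DI Iy <-]] /=.
by rewrite /commutator (sb_core_comm Ix Iy) !gnorm.
Qed.

Lemma sb_series_square n : sb_series A n.+1 `<=` P.
Proof.
apply: generated_sub => // _ [x _ [y _ <-]]; exact: sb_square_star.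
Qed.

(** Modulo [Q], [x ⊚ y] is [y ⊕ x], so [x ⋆ y] becomes the additive commutator of [x] and [⊖ y]. *)
Lemma sb_series_derived n x : sb_series A n x ->
  exists2 d, derived_series G n d & Q (d ⊕ ⊖ x).
Proof.
elim: n x => [|n IHn] x; first by exists x; rewrite ?gop_invr //; apply: subgroup_id.
have gD := generated_subgroup G.
apply: (generated_sub (H := [set x | exists2 d, derived_series G n.+1 d & Q (d ⊕ ⊖ x)])).
  split=> [|{}x y [d Dd Qdx] [d' Dd' Qdy]|{}x [d Dd Qdx]].
  - exists (gid G); first exact: derived_series_id.
    by rewrite gop_invr; apply: subgroup_id.
  - exists (d ⊕ d'); first exact: (subgroupM (gD _)).
    have -> : d ⊕ d' ⊕ ⊖ (x ⊕ y) = d ⊕ (d' ⊕ ⊖ y) ⊕ ⊖ d ⊕ (d ⊕ ⊖ x).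
      by rewrite !gnorm.
    by apply: (subgroupM gQ) => //; apply: sb_opsquare_normal.
  - exists (⊖ d); first exact: (subgroupV (gD _)).
    have -> : ⊖ d ⊕ ⊖ ⊖ x = ⊖ d ⊕ ⊖ (d ⊕ ⊖ x) ⊕ ⊖ ⊖ d by rewrite !gnorm.
    by apply: sb_opsquare_normal; apply: (subgroupV gQ).
move=> _ [{}x /IHn[d Dd Qdx] [y /IHn[d' Dd' Qdy] <-]].
exists (commutator G d (⊖ d')).
  apply: sub_generated; exists d => //; exists (⊖ d') => //.
  by case: n Dd' {IHn Dd} => [//|n]; apply: (subgroupV (gD _)).
set u := d ⊕ ⊖ x in Qdx; set v := d' ⊕ ⊖ y in Qdy.
have -> : commutator G d (⊖ d') ⊕ ⊖ (x ⋆ y) =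
    ⊖ x ⊕ (⊖ u ⊕ v ⊕ (y ⊕ u ⊕ ⊖ y) ⊕
      (y ⊕ x ⊕ ⊖ y ⊕ ⊖ v ⊕ ⊖ (y ⊕ x ⊕ ⊖ y)) ⊕
      (y ⊕ ⊖ (x ⋇ y) ⊕ ⊖ y)) ⊕ ⊖ ⊖ x.
  by rewrite /commutator /u /v /sb_star /sb_opstar !gnorm.
have QM := subgroupM gQ; have QV a : Q a -> Q (⊖ a) := @subgroupV _ G Q a gQ.
have QN a h : Q h -> Q (a ⊕ h ⊕ ⊖ a) := @sb_opsquare_normal a h.
have Qxy := sb_opsquare_star x y.
exact: (QN _ _ (QM _ _ (QM _ _ (QM _ _ (QM _ _ (QV _ Qdx) Qdy) (QN _ _ Qdx))
  (QN _ _ (QV _ Qdy))) (QN _ _ (QV _ Qxy)))).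
Qed.

Lemma sb_series_core n :
  derived_series G n = [set gid G] -> sb_series A n.+1 `<=` I.
Proof.
move=> Dn x Sx; split; first exact: sb_series_square Sx.
have [d] := sb_series_derived Sx.
(* The shift to [n.+1] comes from [P], which is reached only after one application of the star
   product. *)
suff -> : derived_series G n.+1 = [set gid G].
  by move=> -> /(subgroupV gQ); rewrite !gnorm.
apply/seteqP; split; last by move=> _ ->; apply: derived_series_id.
apply: generated_sub.
  split=> //= [z y -> ->|z ->]; first by rewrite gop_idl.
  by rewrite ginv_id.
have D1 z : derived_series G n z -> z = gid G by rewrite Dn.
by move=> _ [z /D1 -> [y /D1 -> <-]]; rewrite /commutator /= !gnorm.
Qed.

(** [Z k] is the preimage in [I] of the elements [z] of [R] with [z R^k = 0]. Strict chains of
    subgroups inside [R] pull back to strict chains in [A], for either law, so the chain condition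
    reaches [R]. The star product serves the series of the brace, the commutator the derived series
    of [C]. *)
Lemma sb_core_filtration : max_subgroups G \/ max_subgroups C ->
  exists m (Z : nat -> set A), [/\ Z 0%N = [set gid G], I `<=` Z m,
    forall k, subgroup G (Z k), forall k, subgroup C (Z k)
  & forall k x y, Z k.+1 x -> Z k.+1 y -> Z k (x ⋆ y) /\ Z k (commutator C x y)].
Proof.
move=> maxA.
have [S [j [j_inj jD jM jI]]] := nonunital_ring_embedding gI sb_core_comm
  sb_core_star sb_core_starA sb_core_starDl (fun x y z => @sb_core_starDr x y z).
set R := j @` I in jI.
have gC := sb_core_circ_subgroup.
have j0 : j (gid G) = 0.
  apply: (@addrI _ (j (gid G))).
  by rewrite -jD ?gop_idl ?addr0 //; apply: (subgroup_id gI).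
have jV x : I x -> j (⊖ x) = - j x.
  move=> Ix; apply: (@addrI _ (j x)).
  by rewrite -jD ?gop_invr ?j0 ?subrr //; apply: (subgroupV gI).
have jC x y : I x -> I y -> j (x ⊚ y) = j x + j y + j x * j y.
  move=> Ix Iy; have Ixy := sb_core_star Ix Iy.
  rewrite sb_circE (jD _ _ (subgroupM gI Ix Ixy) Iy) (jD _ _ Ix Ixy) jM //.
  by rewrite addrAC.
have j1C x y : I x -> I y -> 1 + j (x ⊚ y) = (1 + j x) * (1 + j y).
  by move=> Ix Iy; rewrite one_add_circ jC.
have j_inv x : I x -> circ_inverse (j x) (j (ginv C x)).
  move=> Ix; have Ix' := sb_core_circV Ix; rewrite /circ_inverse -!j1C //.
  by rewrite gop_invr gop_invl sb_id j0 addr0.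
have R_inv s : R s -> exists2 t, R t & circ_inverse s t.
  move=> [x Ix <-]; exists (j (ginv C x)); last exact: j_inv.
  by exists (ginv C x) => //; apply: sb_core_circV.
pose pull (H : set S) : set A := [set x | I x /\ H (j x)].
have pull_lt (H K : set S) : H `<=` R -> K `<=` R -> H `<` K -> pull H `<` pull K.
  move=> HR KR [HK nKH]; split; first by move=> x [Ix Hx]; split=> //; apply: HK.
  move=> KH; apply: nKH => s Ks; have [x Ix xs] := KR _ Ks.
  by have [] := KH x; rewrite ?xs //; split=> //; rewrite xs.
have pull_add H : add_subgroup H -> subgroup G (pull H).
  move=> aH; have [H0 HB] := aH; split.
  - by split; [apply: (subgroup_id gI)|rewrite j0].
  - move=> x y [Ix Hx] [Iy Hy]; split; first exact: (subgroupM gI).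
    by rewrite jD //; apply: add_subgroupD.
  - move=> x [Ix Hx]; split; first exact: (subgroupV gI).
    by rewrite jV // -sub0r; apply: HB.
have pull_circ H : circ_subgroup H -> subgroup C (pull H).
  move=> [H0 HM HV]; split.
  - by split; [apply: (subgroup_id gC)|rewrite sb_id j0].
  - move=> x y [Ix Hx] [Iy Hy]; split; first exact: (subgroupM gC).
    by rewrite jC //; apply: HM.
  - move=> x [Ix Hx]; split; first exact: (subgroupV gC).
    by apply: HV Hx; apply: j_inv.
have R_acc : acc (within R (@add_subgroup S)) \/ acc (within R (@circ_subgroup S)).
  case: maxA => maxA; [left|right] => -[H [HR Hlt]]; apply: maxA;
    exists (fun n => pull (H n)); split=> n.
  - by apply: pull_add; case: (HR n).
  - by apply: pull_lt; [case: (HR n)|case: (HR n.+1)|].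
  - by apply: pull_circ; case: (HR n).
  - by apply: pull_lt; [case: (HR n)|case: (HR n.+1)|].
have [m Rm] := radical_nilpotent jI R_inv R_acc.
exists m, (fun k => pull (annih R [set 0] k)); split.
- apply/seteqP; split=> [x [Ix /= jx0]|_ ->].
    by apply: j_inj => //; [apply: (subgroup_id gI)|rewrite j0].
  by split; [apply: (subgroup_id gI)|rewrite /= j0].
- by move=> x Ix; split=> //; apply: Rm; exists x.
- by move=> k; apply: pull_add; apply: annih0_add_subgroup.
- by move=> k; apply: pull_circ; apply: annih0_circ_subgroup.
move=> k x y [Ix Zx] [Iy Zy]; split; split; first exact: sb_core_star.
- by rewrite jM //; case: Zx => _; apply; exists y.
- by do ![apply: (subgroupM gC)] => //; apply: (subgroupV gC).
have Ic : I (commutator C x y).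
  by do ![apply: (subgroupM gC)] => //; apply: (subgroupV gC).
apply: (annih0_circ_commutator jI R_inv Zx Zy).
by rewrite -!j1C //; [rewrite /commutator !gnorm|exact: (subgroupM gC)].
Qed.

Lemma soluble_circ_of_add : max_subgroups G \/ max_subgroups C ->
  soluble_group G -> soluble_group C.
Proof.
move=> /sb_core_filtration[m [Z [Z0 IZ _ gZ cZ]]] [n /derived_series_circ_core DI].
apply: (@soluble_of_sub _ C (m + n)%N); rewrite sb_id -Z0.
apply: derived_series_descent => //; first by move=> k x y /cZ/[apply] -[].
exact: subset_trans IZ.
Qed.

Lemma soluble_brace_of_add : max_subgroups G \/ max_subgroups C ->
  soluble_group G -> soluble_brace A.
Proof.
move=> /sb_core_filtration[m [Z [Z0 IZ gZ _ cZ]]] [n /sb_series_core SI].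
exists (m + n.+1)%N; apply/seteqP; split; last first.
  by rewrite addnS => _ ->; apply: subgroup_id; apply: generated_subgroup.
rewrite -Z0; suff H k : (k <= m)%N -> sb_series A (k + n.+1)%N `<=` Z (m - k)%N.
  by have := H m; rewrite subnn; apply.
elim: k => [|k IHk] km; first by rewrite subn0; apply: subset_trans IZ.
apply: generated_sub => // _ [x Sx [y Sy <-]].
have IH z : sb_series A (k + n.+1)%N z -> Z (m - k.+1).+1 z.
  by rewrite subnSK // => Sz; apply: IHk => //; apply: ltnW.
by have [] := cZ _ _ _ (IH _ Sx) (IH _ Sy).
Qed.

End Brace.

Theorem theorem4p20 (A : skewBrace) :
  two_sided A ->
  max_subgroups (sb_add A) \/ max_subgroups (sb_circ A) ->
  (soluble_group (sb_add A) <-> soluble_group (sb_circ A)) /\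
  (soluble_group (sb_add A) -> soluble_brace A).
Proof.
move=> A2 maxA; split; last exact: soluble_brace_of_add.
split; [exact: soluble_circ_of_add|exact: soluble_add_of_circ].
Qed.
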